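(* Let $p$ be an odd prime and $m>1$. Let $\alpha$ be a primitive element of $GF(p^{2m})$, let $\omega=\alpha^{p^m+1}$ (a primitive element of $GF(p^m)$), and let $e=\frac{p^m-1}{p-1}$. Let $D=\{i \in \{0,1,\ldots,e-1\} : Tr_{m/1}(\omega^i)=0\}$, regarded as a subset of $\mathbb{Z}_e$ (this is a $(\frac{p^m-1}{p-1},\frac{p^{m-1}-1}{p-1},\frac{p^{m-2}-1}{p-1})$ Singer difference set in $(\mathbb{Z}_e,+)$). For $0 \leq i \leq e-1$ let $C_i^{e,2m}=\alpha^i\langle\alpha^e\rangle$ be the $i$-th cyclotomic class of order $e$ in $GF(p^{2m})$. Then (i) $X=\bigcup_{j \in D} C_j^{e,2m}$ is a regular $(p^{2m},\ p^{2m-1}-p^{m-1}(p-1)-1,\ p^{2m-2}-p^{m-1}(p-1)-2,\ p^{2m-2}-p^{m-1})$-partial difference set in the additive group of $GF(p^{2m})$; (ii) $X=\{x \in GF(p^{2m}) \setminus \{0\} : Tr_{m/1}(x^{p^m+1})=0\}$.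
   Context: $Tr_{m/1}(y)=y+y^p+\cdots+y^{p^{m-1}}$ is the trace map from $GF(p^m)$ to $GF(p)$. A $k$-subset $S$ of a finite additive group $G$ of order $v$ is a $(v,k,\lambda,\mu)$ partial difference set if the multiset $\{s_1-s_2: s_1,s_2 \in S\}$ contains every element of $S\setminus\{0\}$ exactly $\lambda$ times and every element of $G \setminus (S \cup\{0\})$ exactly $\mu$ times; it is regular if $S=-S$ and $0 \notin S$. *)

(* Defs.v *)
From HB Require Import structures.
From mathcomp Require Import all_boot all_order all_algebra all_fingroup.
From mathcomp Require Import all_solvable all_field.

Set Implicit Arguments.
Unset Strict Implicit.
Unset Printing Implicit Defensive.

Import GRing.Theory.
Local Open Scope ring_scope.

(* Tr_{m/1}; when y lies in the subfield GF(p^m) of F this is the trace of y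
   from GF(p^m) down to GF(p). *)
Definition Tr (F : finFieldType) (p m : nat) (y : F) : F :=
  \sum_(i < m) y ^+ (p ^ i).

Definition diff_mult (G : finZmodType) (S : {set G}) (g : G) : nat :=
  #|[set s : G * G | (s.1 \in S) && (s.2 \in S) && (s.1 - s.2 == g)]|.

Definition partial_difference_set (G : finZmodType) (S : {set G})
    (v k lambda mu : nat) : Prop :=
  [/\ #|G| = v,
      #|S| = k,
      forall g : G, g \in S -> g != 0 -> diff_mult S g = lambda
    & forall g : G, g \notin S -> g != 0 -> diff_mult S g = mu].

Definition regular_pds (G : finZmodType) (S : {set G})
    (v k lambda mu : nat) : Prop :=
  [/\ partial_difference_set S v k lambda mu,
      S = [set - s | s in S]
    & 0 \notin S].

(* alpha^i <alpha^e>, a coset in the multiplicative group, viewed in F. *)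
Definition cyclotomic_class (F : finFieldType) (alpha : {unit F}) (e i : nat) :
    {set F} :=
  [set val u | u in ((alpha ^+ i)%g *: <[(alpha ^+ e)%g]>)%g].

(* Main.v *)
(* With q = p^m, Q(x) = Tr(x^(q+1)) is a quadratic form over GF(p) on GF(q^2)
   with polar form B, and X is its set of nonzero zeros.  Scaling by alpha^e
   multiplies Q by an element of GF(p)^*, which gives (ii).  The zeros of Q are
   counted as the roots of a divisor of 'X^(q^2) - 'X.  If Q(g) = 0, then each
   line x + GF(p) g with B(x, g) != 0 contains exactly one zero of Q, which gives
   lambda.  The similitudes of Q (multiplications by elements of norm in GF(p)^*,
   and reflections) act transitively on {g : Q(g) != 0}, so the multiplicity of g
   as a difference is constant there, and counting all pairs of X yields mu. *)

Require Import Defs.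
From mathcomp Require Import all_boot all_order all_algebra all_fingroup.
From mathcomp Require Import all_solvable all_field.
From mathcomp Require Import zify ring.

Import GRing.Theory.
Local Open Scope ring_scope.

Set Implicit Arguments.
Unset Strict Implicit.
Unset Printing Implicit Defensive.

(** * Root counts for polynomials over a finite field *)

Lemma card_roots_lt_size (F : finFieldType) (P : {poly F}) :
  P != 0 -> (#|[set x | root P x]| < size P)%N.
Proof.
move=> nzP; rewrite cardE; apply: max_poly_roots (enum_uniq _) => //.
by apply/allP => x; rewrite mem_enum inE.
Qed.

(** Each factor has at most as many roots as its degree, the degrees add up to [#|F|], and together
    the roots cover [F]; so both bounds are attained. *)
Lemma card_roots_complementary (F : finFieldType) (G H : {poly F}) :
    size (G * H) = #|F|.+1 -> (forall x, root (G * H) x) ->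
  #|[set x | root G x]| = (size G).-1.
Proof.
move=> szGH rootGH.
have nzGH : G * H != 0 by rewrite -size_poly_eq0 szGH.
have /andP[nzG nzH] : (G != 0) && (H != 0) by rewrite -negb_or -mulf_eq0.
have szE : (size G + size H = #|F|.+2)%N.
  move: szGH (nzG); rewrite size_mul // -size_poly_gt0.
  by move: (size G) (size H) => a b; lia.
have := card_roots_lt_size nzG; have := card_roots_lt_size nzH.
have: (#|F| <= #|[set x | root G x]| + #|[set x | root H x]|)%N.
  rewrite -cardsT; apply: leq_trans (leq_card_setU _ _); apply/subset_leq_card.
  by apply/subsetP => x _; rewrite !inE -rootM.
lia.
Qed.

Lemma size_sum_Xn (R : nzRingType) (d : nat -> nat) (n : nat) :
    {homo d : i j / (i < j)%N} ->
  size (\sum_(i < n.+1) 'X^(d i) : {poly R}) = (d n).+1.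
Proof.
move=> d_lt; elim: n => [|n IHn]; first by rewrite big_ord1 size_polyXn.
by rewrite big_ord_recr /= addrC size_polyDl ?size_polyXn // IHn ltnS d_lt.
Qed.

Lemma exprp1 (F : fieldType) (p : nat) (t : F) :
  (0 < p)%N -> t ^+ p = t -> t != 0 -> t ^+ (p - 1) = 1.
Proof.
by move=> p_gt0 tp nzt; apply: (mulIf nzt); rewrite mul1r -exprSr subn1 prednK.
Qed.

(* When [P] takes values in GF(p), [P ^+ (p - 1) - 1] vanishes at the non-zeros
   of [P]; [G] is [P] with the multiplicity of its zeros reduced. *)
Lemma card_zeros_prime_valued (F : finFieldType) (p : nat) (G P : {poly F}) :
    (1 < p)%N -> (1 < size P)%N -> (0 < size G)%N ->
    (forall x, P.[x] ^+ p = P.[x]) -> (forall x, root G x = root P x) ->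
    ((size G).-1 + (p - 1) * (size P).-1 = #|F|)%N ->
  #|[set x | P.[x] == 0]| = (size G).-1.
Proof.
move=> p_gt1 szP szG Pp GP szE.
have szPX : size (P ^+ (p - 1)) = ((size P).-1 * (p - 1)).+1.
  have: P ^+ (p - 1) != 0 by rewrite expf_neq0 // -size_poly_gt0 ltnW.
  by rewrite -size_exp -size_poly_gt0 => /prednK ->.
have szH : size (P ^+ (p - 1) - 1) = size (P ^+ (p - 1)).
  rewrite size_polyDl // size_polyN size_poly1 szPX ltnS muln_gt0 subn_gt0 p_gt1 andbT.
  by rewrite -ltnS prednK // ltnW.
rewrite -(@card_roots_complementary _ G (P ^+ (p - 1) - 1)).
- by apply: eq_card => x; rewrite !inE GP.
- rewrite size_mul ?szH ?szPX -?size_poly_gt0 ?szH ?szPX //.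
  by rewrite -szE addnS mulnC /= -addSn prednK.
move=> x; rewrite rootM GP; have [//|nzP] := boolP (root P x).
by rewrite /root !hornerE exprp1 ?subrr ?eqxx // ltnW.
Qed.

(** * The trace map and the prime subfield *)

Section Trace.

Variables (F : finFieldType) (p : nat).
Hypothesis pcharFp : p \in [pchar F].

Let p_prime : prime p. Proof. exact: pcharf_prime pcharFp. Qed.
Let p_gt1 : (1 < p)%N. Proof. exact: prime_gt1. Qed.

Lemma exprDpn (x y : F) (n : nat) :
  (x + y) ^+ (p ^ n) = x ^+ (p ^ n) + y ^+ (p ^ n).
Proof.
rewrite exprDn_pchar // pnatX; apply/orP; left.
by rewrite (eq_pnat _ (pcharf_eq pcharFp)) pnat_id.
Qed.

Lemma expr_pn_fixed (t : F) (n : nat) : t ^+ p = t -> t ^+ (p ^ n) = t.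
Proof. by move=> tp; elim: n => // n IHn; rewrite expnS exprM tp. Qed.

Lemma card_prime_subfield : #|[set t : F | t ^+ p == t]| = p.
Proof.
have szP : size ('X^p - 'X : {poly F}) = p.+1.
  by rewrite size_polyDl ?size_polyXn // size_polyN size_polyX ltnS.
apply/eqP; rewrite eqn_leq; apply/andP; split.
  rewrite -ltnS -szP; apply: leq_ltn_trans (card_roots_lt_size _); last first.
    by rewrite -size_poly_gt0 szP.
  apply/subset_leq_card/subsetP => t.
  by rewrite !inE /root !hornerE subr_eq0.
have natr_inj : injective (fun k : 'I_p => k%:R : F).
  have wlog_le (i j : 'I_p) : (i <= j)%N -> i%:R = j%:R :> F -> i = j.
    move=> le_ij eq_ij; apply/val_inj/eqP; rewrite eqn_leq le_ij /=.
    have: (p %| j - i)%N by rewrite (dvdn_pcharf pcharFp) natrB // eq_ij subrr.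
    apply: contraLR; rewrite -ltnNge => lt_ij; apply/negP => /dvdn_leq.
    by rewrite subn_gt0 lt_ij => /(_ isT); have := ltn_ord j; lia.
  by move=> i j eq_ij; case: (leqP i j) => [|/ltnW] le; [|symmetry]; apply: wlog_le.
rewrite -[X in (X <= _)%N]card_ord -(card_imset _ natr_inj).
apply/subset_leq_card/subsetP => _ /imsetP[k _ ->].
by rewrite inE -(pFrobenius_autE pcharFp) pFrobenius_aut_nat.
Qed.

Lemma TrD n : {morph @Tr F p n : x y / x + y}.
Proof.
by move=> x y; rewrite /Tr -big_split; apply: eq_bigr => i _; apply: exprDpn.
Qed.

Lemma TrZ n (t x : F) : t ^+ p = t -> Tr p n (t * x) = t * Tr p n x.
Proof.
move=> tp; rewrite /Tr mulr_sumr; apply: eq_bigr => i _.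
by rewrite exprMn (expr_pn_fixed _ tp).
Qed.

(** Frobenius shifts the terms of the sum cyclically: the last one becomes [x ^+ (p ^ n) = x], the
    first. *)
Lemma Tr_fixed n (x : F) : x ^+ (p ^ n) = x -> Tr p n x ^+ p = Tr p n x.
Proof.
rewrite /Tr -(pFrobenius_autE pcharFp) rmorph_sum /=.
case: n => [|n] xq; first by rewrite !big_ord0.
rewrite big_ord_recr big_ord_recl /= addrC !pFrobenius_autE expn0 expr1.
rewrite -exprM -expnSr xq; congr (_ + _); apply: eq_bigr => i _.
by rewrite pFrobenius_autE -exprM -expnSr.
Qed.

Lemma Tr_add m n (x : F) :
  Tr p (m + n) x = Tr p m x + Tr p n (x ^+ (p ^ m)).
Proof.
rewrite /Tr big_split_ord; congr (_ + _); apply: eq_bigr => i _ /=.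
by rewrite expnD exprM.
Qed.

(** The trace polynomial has degree [p ^ n.-1], and p times this is [#|F|], so
    [card_zeros_prime_valued] applies with [G = P]: all its zeros are simple. *)
Lemma card_Tr_eq0 n : (0 < n)%N -> #|F| = (p ^ n)%N ->
  #|[set x : F | Tr p n x == 0]| = (p ^ n.-1)%N.
Proof.
case: n => // n _ cardF.
pose P : {poly F} := \sum_(i < n.+1) 'X^(p ^ i).
have PE x : P.[x] = Tr p n.+1 x.
  by rewrite horner_sum; apply: eq_bigr => i _; rewrite hornerXn.
have szP : size P = (p ^ n).+1.
  by apply: size_sum_Xn => i j; rewrite ltn_exp2l.
have pn_gt0 : (0 < p ^ n)%N by rewrite expn_gt0 ltnW.
rewrite -[RHS]/((p ^ n).+1.-1) -szP -(@card_zeros_prime_valued _ p P P) ?szP //.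
- by apply: eq_card => x; rewrite !inE PE.
- by move=> x; rewrite PE Tr_fixed // -cardF expf_card.
by rewrite cardF /= expnS; nia.
Qed.

End Trace.

(** * Multiplicities of differences in a finite abelian group *)

Section DiffMult.

Variable G : finZmodType.
Implicit Types (S : {set G}) (g : G).

Lemma diff_multE S g : diff_mult S g = #|[set x | (x \in S) && (x + g \in S)]|.
Proof.
have inj : injective (fun x => (x + g, x)) by move=> x y [].
rewrite -(card_imset _ inj); apply: eq_card => -[x y]; rewrite !inE /=.
apply/andP/imsetP => [[/andP[Sx Sy] /eqP <-]|[z]].
  by exists y; rewrite ?inE addrC subrK ?Sy.
by rewrite inE => /andP[Sz Szg] [-> ->]; rewrite Sz Szg addrC addKr.
Qed.

Lemma diff_mult0 S : diff_mult S 0 = #|S|.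
Proof. by rewrite diff_multE; apply: eq_card => x; rewrite inE addr0 andbb. Qed.

Lemma sum_diff_mult S : (\sum_g diff_mult S g = #|S| ^ 2)%N.
Proof.
under eq_bigr do rewrite diff_multE -sum1dep_card big_mkcondr.
rewrite exchange_big /= -mulnn -sum_nat_const; apply: eq_bigr => x _.
rewrite -big_mkcond sum1dep_card -[RHS](card_preimset _ (@addrI G x)).
by apply: eq_card => g; rewrite !inE.
Qed.

Lemma diff_mult_morph S (f : G -> G) g : injective f -> {morph f : x y / x + y} ->
  (forall x, (f x \in S) = (x \in S)) -> diff_mult S (f g) = diff_mult S g.
Proof.
move=> f_inj fD fS; rewrite !diff_multE -[LHS](card_preimset _ f_inj).
by apply: eq_card => x; rewrite !inE -fD !fS.
Qed.

Lemma diff_multN S g : diff_mult S (- g) = diff_mult S g.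
Proof.
rewrite !diff_multE -[LHS](card_preimset _ (@addIr G g)).
by apply: eq_card => x; rewrite !inE addrK andbC.
Qed.

End DiffMult.
(* The hypothesis is |X|^2 = sum of the multiplicities of all differences, for
   [a = p ^ m.-1], with [d] the unknown multiplicity outside [X]. *)
Lemma pds_mu_solve (p a d : nat) : (2 < p)%N -> (p <= a)%N ->
    ((p * a + 1) * (a - 1)
      + ((p * a + 1) * (a - 1) * (a * a - a * (p - 1) - 2)
         + (p * a * (p * a) - (a * (p * a + 1) - p * a)) * d)
     = ((p * a + 1) * (a - 1)) ^ 2)%N ->
  d = (a * a - a)%N.
Proof.
case: a => [|b]; first by case: p.
case: p => // s s_gt1 le_sb; rewrite !subn1 /=.
(* With p = s + 1 and a = b + 1, this bound keeps the subtractions in lambda from truncating. *)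
have le1 : (b.+1 * s + 2 <= b.+1 * b.+1)%N.
  by have := leq_mul (leqnn b.+1) le_sb; rewrite !mulnS; lia.
(* This is k = lambda + 1 + (p - 1) a^2. Multiplied by k and compared with the hypothesis, it leaves
   k (p - 1) a^2 = W d, where W is the number of elements of multiplicity d. *)
have KE : ((s.+1 * b.+1 + 1) * b
    = (b.+1 * b.+1 - b.+1 * s - 2) + 1 + s * (b.+1 * b.+1))%N by lia.
(* W factors as (p - 1) a (p a + 1), which is positive and can be cancelled. *)
have -> : (s.+1 * b.+1 * (s.+1 * b.+1) - (b.+1 * (s.+1 * b.+1 + 1) - s.+1 * b.+1)
    = s * b.+1 * (s.+1 * b.+1 + 1))%N.
  have -> : (b.+1 * (s.+1 * b.+1 + 1)
      = b.+1 * (s.+1 * b + 1) + s.+1 * b.+1)%N by ring.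
  have -> : (s.+1 * b.+1 * (s.+1 * b.+1)
      = s * b.+1 * (s.+1 * b.+1 + 1) + b.+1 * (s.+1 * b + 1))%N by ring.
  by rewrite !addnK.
have W_gt0 : (0 < s * b.+1 * (s.+1 * b.+1 + 1))%N.
  by rewrite !muln_gt0 addn1 /= andbT ltnW.
move=> sumE; apply/eqP; rewrite -(eqn_pmul2l W_gt0); apply/eqP; move: sumE.
have -> : (s * b.+1 * (s.+1 * b.+1 + 1) * (b.+1 * b.+1 - b.+1)
    = (s.+1 * b.+1 + 1) * b * (s * (b.+1 * b.+1)))%N.
  have -> : (b.+1 * b.+1 - b.+1 = b.+1 * b)%N by rewrite mulnS addKn.
  by ring.
move: KE; move: ((s.+1 * b.+1 + 1) * b)%N (b.+1 * b.+1 - b.+1 * s - 2)%N => K l.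
move: (s * (b.+1 * b.+1))%N (s * b.+1 * (s.+1 * b.+1 + 1) * d)%N => t w KE.
have := congr1 (muln K) KE; rewrite !mulnDr muln1 -mulnn.
by clear; lia.
Qed.

(** * The quadratic form and its polar form *)

Section Quadric.

Variables (F : finFieldType) (p m : nat).
Hypotheses (p_odd : odd p) (m_gt1 : (1 < m)%N) (pcharFp : p \in [pchar F]).
Hypothesis cardF : #|F| = (p ^ (2 * m))%N.

Let p_prime : prime p. Proof. exact: pcharf_prime pcharFp. Qed.
Let p_gt2 : (2 < p)%N. Proof. by rewrite odd_prime_gt2. Qed.
Let p_gt1 : (1 < p)%N. Proof. exact: ltnW. Qed.
Let p_gt0 : (0 < p)%N. Proof. exact: ltnW. Qed.

Local Notation q := (p ^ m)%N.

Definition qform (x : F) : F := Tr p m (x ^+ (q + 1)).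

Definition polar (x y : F) : F := Tr p m (x ^+ q * y + x * y ^+ q).

Definition quadric : {set F} := [set x | (x != 0) && (qform x == 0)].

Lemma exprqq (x : F) : x ^+ q ^+ q = x.
Proof. by rewrite -exprM -expnD addnn -mul2n -cardF expf_card. Qed.

(** The norm [x ^+ (q + 1)] is fixed by the q-th power map, since [x ^+ q ^+ q = x]; hence its trace
    lies in GF(p). *)
Lemma qform_fixed x : qform x ^+ p = qform x.
Proof.
apply: Tr_fixed => //.
by rewrite -exprM mulnDl mul1n exprD exprM exprqq -exprS addn1.
Qed.

Lemma polar_fixed x y : polar x y ^+ p = polar x y.
Proof.
by apply: Tr_fixed => //; rewrite exprDpn // !exprMn !exprqq addrC.
Qed.

Lemma qformD x y : qform (x + y) = qform x + qform y + polar x y.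
Proof.
rewrite /qform /polar -!TrD // !addn1 !exprSr exprDpn //; congr (Tr p m _); ring.
Qed.

Lemma polarC x y : polar x y = polar y x.
Proof. by congr (Tr p m _); ring. Qed.

Lemma polarDl x y z : polar (x + y) z = polar x z + polar y z.
Proof.
rewrite /polar -TrD // exprDpn //; congr (Tr p m _); ring.
Qed.

Lemma polarZl t x y : t ^+ p = t -> polar (t * x) y = t * polar x y.
Proof.
move=> tp; rewrite /polar -TrZ // exprMn (expr_pn_fixed _ tp).
by congr (Tr p m _); ring.
Qed.

Lemma polarxx x : polar x x = 2%:R * qform x.
Proof.
rewrite /polar /qform -exprSr -exprS -addn1 -TrZ ?mulr_natl //.
by rewrite -(pFrobenius_autE pcharFp) pFrobenius_aut_nat.
Qed.

Lemma qform_mul u x : u ^+ (q + 1) ^+ p = u ^+ (q + 1) ->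
  qform (u * x) = u ^+ (q + 1) * qform x.
Proof. by move=> up; rewrite /qform exprMn TrZ. Qed.

Lemma qformZ t x : t ^+ p = t -> qform (t * x) = t ^+ 2 * qform x.
Proof.
move=> tp; have tq : t ^+ (q + 1) = t ^+ 2.
  by rewrite addn1 exprSr (expr_pn_fixed _ tp).
by rewrite qform_mul tq // exprAC tp.
Qed.

Lemma qform_line x t g : t ^+ p = t ->
  qform (x + t * g) = qform x + t * polar x g + t ^+ 2 * qform g.
Proof.
by move=> tp; rewrite qformD qformZ // polarC polarZl // polarC addrAC.
Qed.

Lemma qform0 : qform 0 = 0.
Proof. by rewrite -[X in qform X](mulr0 0) qformZ expr0n ?mul0r // gtn_eqF. Qed.

Lemma qformN x : qform (- x) = qform x.
Proof.
rewrite -mulN1r qformZ ?sqrrN ?expr1n ?mul1r //.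
by rewrite -signr_odd p_odd expr1.
Qed.

(** * Counting zeros of the two forms *)

(** By [Tr_add], [polar x g] is the absolute trace of [g ^+ q * x], and multiplication by [g ^+ q]
    is a bijection. *)
Lemma card_polar_eq0 g : g != 0 ->
  #|[set x | polar x g == 0]| = (p ^ (2 * m).-1)%N.
Proof.
move=> nzg; rewrite -(card_Tr_eq0 pcharFp _ cardF); last by rewrite muln_gt0 (ltnW m_gt1).
rewrite -[RHS](card_preimset _ (mulfI (expf_neq0 q nzg))).
apply: eq_card => x; rewrite !inE mul2n -addnn Tr_add -TrD //.
by rewrite exprMn exprqq polarC.
Qed.

(* [qform] is a polynomial of degree [p ^ m.-1 * (q + 1)] vanishing to order
   [q + 1] at 0; lowering that order to 1 gives a divisor of 'X^#|F| - 'X. *)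
Lemma card_qform_eq0 :
  #|[set x | qform x == 0]| = (p ^ m.-1 * (q + 1) - q)%N.
Proof.
have mE : m = m.-1.+1 by rewrite prednK // ltnW.
move: m.-1 mE => n mE.
pose P : {poly F} := \sum_(i < n.+1) 'X^((q + 1) * p ^ i).
pose G : {poly F} := \sum_(i < n.+1) 'X^((q + 1) * p ^ i - q).
have q_lt i : (q < (q + 1) * p ^ i)%N.
  by rewrite addn1 leq_pmulr // expn_gt0 p_gt0.
have PE x : P.[x] = qform x.
  rewrite horner_sum /qform /Tr mE; apply: eq_bigr => i _.
  by rewrite hornerXn exprM.
have GP : P = G * 'X^q.
  rewrite mulr_suml; apply: eq_bigr => i _; rewrite -exprD subnK //.
  exact: ltnW.
have d_lt i j : (i < j)%N -> ((q + 1) * p ^ i < (q + 1) * p ^ j)%N.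
  by move=> lt_ij; rewrite ltn_pmul2l ?addn1 // ltn_exp2l.
have szP : size P = ((q + 1) * p ^ n).+1.
  exact: (@size_sum_Xn _ (fun i => (q + 1) * p ^ i)%N).
have szG : size G = ((q + 1) * p ^ n - q).+1.
  apply: (@size_sum_Xn _ (fun i => (q + 1) * p ^ i - q)%N) => i j /d_lt.
  by have := q_lt i; have := q_lt j; lia.
rewrite mulnC -[RHS]/(_.+1.-1) -szG.
rewrite -(@card_zeros_prime_valued _ p G P) ?szP ?szG //.
- by apply: eq_card => x; rewrite !inE PE.
- by rewrite ltnS muln_gt0 addn1 expn_gt0 p_gt0.
- by move=> x; rewrite PE qform_fixed.
(* Division by 'X^q keeps the root 0, because every exponent left in [G] is positive. *)
- move=> x; rewrite GP rootM; case: (eqVneq x 0) => [->|nzx]; last first.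
    by rewrite /root !hornerE expf_eq0 (negPf nzx) andbF orbF.
  rewrite /root horner_sum big1 ?eqxx // => i _.
  by rewrite hornerXn expr0n subn_eq0 leqNgt q_lt.
(* The degrees add up to p (q + 1) p^n - q = q (q + 1) - q = q^2. *)
rewrite cardF mul2n -addnn expnD addnC addnBA; last exact: ltnW (q_lt n).
rewrite addnC -mulSn subn1 prednK // {q_lt d_lt szP szG GP PE P G} mE expnS.
by move: (p ^ n)%N => a; nia.
Qed.

Lemma card_qform_polar g : g != 0 -> qform g = 0 ->
  (p * #|[set x | (qform x == 0%R) && (polar x g != 0%R)]|
    = p ^ (2 * m) - p ^ (2 * m).-1)%N.
Proof.
move=> nzg Qg; rewrite -cardF -(card_polar_eq0 nzg).
rewrite -(cardsC [set x | polar x g == 0]) addKn.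
(* When B(x, g) != 0, [s x] is the only t in GF(p) with Q(x + t g) = 0. Translation by t g preserves
   B(., g), so it carries the fibre of [s] over t onto the set being counted. *)
pose s x := - (qform x / polar x g).
have sp x : s x ^+ p = s x.
  rewrite /s -(pFrobenius_autE pcharFp) rmorphN rmorphM fmorphV /=.
  by rewrite !pFrobenius_autE qform_fixed polar_fixed.
rewrite -[in LHS](card_prime_subfield pcharFp) -[RHS]sum1_card.
rewrite (partition_big s (mem [set t : F | t ^+ p == t])) /=; last first.
  by move=> x _; rewrite inE sp.
rewrite -sum_nat_const; apply: eq_bigr => t; rewrite inE => /eqP tp.
rewrite sum1dep_card -[LHS](card_preimset _ (@addIr F (t * g))).
apply: eq_card => x; rewrite !inE polarDl polarZl // polarxx Qg !mulr0 addr0.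
rewrite qform_line // Qg mulr0 addr0 andbC; apply: andb_id2l => nzB.
by rewrite /s -[RHS](inj_eq (mulIf nzB)) mulNr divfK // addrC addr_eq0 eq_sym.
Qed.

(** * Similitudes of the form and their action on differences *)

Lemma norm_surj_prime_subfield (t : F) : t ^+ p = t ->
  exists u, u ^+ (q + 1) = t.
Proof.
move=> tp; have [->|nzt] := eqVneq t 0; first by exists 0; rewrite expr0n addn1.
have /cyclicP[a aE] := field_unit_group_cyclic [set: {unit F}].
have ord_a : #[a]%g = (p ^ (2 * m) - 1)%N.
  by rewrite orderE -aE card_finField_unit cardF subn1.
have ut : t \is a GRing.unit by rewrite unitfE.
have /cycleP[j tE] : FinRing.unit F ut \in <[a]>%g by rewrite -aE inE.
have: (#[a]%g %| j * (p - 1))%N.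
  rewrite order_dvdn expgM -tE; apply/eqP/val_inj.
  by rewrite FinRing.val_unitX /= exprp1.
have qE : (q - 1 = (p - 1) * \sum_(i < m) p ^ i)%N by rewrite !subn1 predn_exp.
(* The group order q^2 - 1 divides j (p - 1); cancelling p - 1 leaves q + 1 as a divisor of j, so t
   = a^j is a norm. *)
have -> : (#[a]%g = (q + 1) * (\sum_(i < m) p ^ i) * (p - 1))%N.
  rewrite ord_a -mulnA (mulnC (\sum_(i < m) p ^ i)%N) -qE mul2n -addnn expnD.
  by have: (0 < q)%N; [rewrite expn_gt0 p_gt0 | nia].
rewrite dvdn_pmul2r ?subn_gt0 // => /dvdnP[k jE].
exists (val (a ^+ (k * \sum_(i < m) p ^ i))%g).
rewrite FinRing.val_unitX -exprM -mulnA [X in (k * X)%N]mulnC -jE.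
by rewrite -FinRing.val_unitX -tE.
Qed.

Lemma quadric_mul u x : u != 0 -> u ^+ (q + 1) ^+ p = u ^+ (q + 1) ->
  (u * x \in quadric) = (x \in quadric).
Proof.
by move=> nzu up; rewrite !inE qform_mul // !mulf_eq0 expf_eq0 (negPf nzu) andbF.
Qed.

(** Since B(h, h) = 2 Q(h), the usual coefficient 2 B(x, h) / B(h, h) becomes B(x, h) / Q(h). The
    shape x + t h suits [qform_line]. *)
Definition reflection (h x : F) : F := x + - (polar x h / qform h) * h.

Let ratio_fixed x h : (- (polar x h / qform h)) ^+ p = - (polar x h / qform h).
Proof.
rewrite -(pFrobenius_autE pcharFp) rmorphN rmorphM fmorphV /=.
by rewrite !pFrobenius_autE qform_fixed polar_fixed.
Qed.

Lemma qform_reflection h x : qform h != 0 -> qform (reflection h x) = qform x.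
Proof. by move=> nzh; rewrite qform_line //; field. Qed.

Lemma reflectionK h : qform h != 0 -> involutive (reflection h).
Proof.
move=> nzh x; rewrite {1}/reflection [polar (reflection h x) h]polarDl.
by rewrite polarZl // polarxx /reflection; field.
Qed.

Lemma reflectionD h : {morph reflection h : x y / x + y}.
Proof. by move=> x y; rewrite /reflection polarDl; ring. Qed.

(** Equal values give B(g, g - h) = 2 Q(g) - B(g, h) = Q(g - h), so the coefficient is -1. *)
Lemma reflection_swap g h : qform g = qform h -> qform (g - h) != 0 ->
  reflection (g - h) g = h.
Proof.
move=> Qgh nzQ; have QE : polar g (g - h) = qform (g - h).
  rewrite polarC polarDl polarxx qformD qformN Qgh polarC.
  ring.
by rewrite /reflection QE divff // mulN1r opprB addrC subrK.
Qed.

(** If Q(g - h) != 0, the reflection along g - h sends g to h. Otherwise Q(g + h) + Q(g - h) = 4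
    Q(h) != 0 for odd p, so the reflection along g + h sends g to -h, which has the same
    multiplicity as h. *)
Lemma diff_mult_qform_eq g h : qform g = qform h -> qform h != 0 ->
  diff_mult quadric g = diff_mult quadric h.
Proof.
have swap a b : qform a = qform b -> qform (a - b) != 0 ->
    diff_mult quadric a = diff_mult quadric b.
  move=> Qab nzQ; rewrite -(reflection_swap Qab nzQ); apply/esym.
  have reflK := reflectionK nzQ; apply: diff_mult_morph.
  - exact: inv_inj reflK.
  - exact: reflectionD.
  have refl0 : reflection (a - b) 0 = 0.
    by apply: (addrI (reflection (a - b) 0)); rewrite -reflectionD !addr0.
  move=> x; rewrite !inE qform_reflection // -{1}refl0.
  by rewrite (inj_eq (inv_inj reflK)).
move=> Qgh nzh; have [Q0|] := eqVneq (qform (g - h)) 0; last exact: swap.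
rewrite -[RHS]diff_multN; apply: swap; rewrite ?qformN // opprK.
apply: contraNneq nzh => Q1.
have: qform (g + h) + qform (g - h) = 4%:R * qform h.
  have polarN : polar g (- h) = - polar g h.
    rewrite polarC -[- h]mulN1r polarZl ?mulN1r 1?polarC //.
    by rewrite -signr_odd p_odd.
  by rewrite !qformD qformN polarN Qgh; ring.
rewrite Q0 Q1 addr0 => /esym/eqP; rewrite mulf_eq0 -(dvdn_pcharf pcharFp).
case/orP => //; rewrite -[4%N]/(2 ^ 2)%N Euclid_dvdX // dvdn_prime2 // => /andP[/eqP p2 _].
by move: p_odd; rewrite p2.
Qed.

(* Scaling by an element whose norm lies in GF(p) reduces to equal values, and
   vectors with equal nonzero values are exchanged by a reflection. *)
Lemma diff_mult_const g h : qform g != 0 -> qform h != 0 ->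
  diff_mult quadric g = diff_mult quadric h.
Proof.
move=> nzg nzh; have tp : (qform h / qform g) ^+ p = qform h / qform g.
  rewrite -(pFrobenius_autE pcharFp) rmorphM fmorphV /=.
  by rewrite !pFrobenius_autE !qform_fixed.
have [u uE] := norm_surj_prime_subfield tp.
have nzu : u != 0.
  apply: contraNneq nzh => u0; move: uE; rewrite u0 expr0n addn1 /= => /esym/eqP.
  by rewrite mulf_eq0 invr_eq0 (negPf nzg) orbF.
have up : u ^+ (q + 1) ^+ p = u ^+ (q + 1) by rewrite uE.
have QE : qform (u * g) = qform h by rewrite qform_mul // uE divfK.
rewrite -(diff_mult_qform_eq QE nzh); apply/esym; apply: diff_mult_morph.
- exact: mulfI.
- exact: mulrDr.
by move=> x; apply: quadric_mul.
Qed.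

(** * The parameters, expressed through a = p^(m-1) and q = p a *)

Let a_ge : (p <= p ^ m.-1)%N.
Proof. by rewrite -{1}[p]expn1 leq_exp2l // -ltnS prednK // ltnW. Qed.

Let mE : m = m.-1.+1. Proof. by rewrite prednK // ltnW. Qed.
Let qE : q = (p * p ^ m.-1)%N. Proof. by rewrite {1}mE expnS. Qed.
Let qqE : (p ^ (2 * m) = (p * p ^ m.-1) * (p * p ^ m.-1))%N.
Proof. by rewrite mul2n -addnn expnD qE. Qed.
Let qqE1 : (p ^ (2 * m).-1 = p * p ^ m.-1 * p ^ m.-1)%N.
Proof.
apply/eqP; rewrite -(eqn_pmul2l p_gt0) -expnS prednK ?qqE; first by nia.
by rewrite muln_gt0 (ltnW m_gt1).
Qed.

Lemma card_quadric :
  #|quadric| = ((p * p ^ m.-1 + 1) * (p ^ m.-1 - 1))%N.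
Proof.
have -> : quadric = [set x | qform x == 0] :\ 0.
  by apply/setP => x; rewrite !inE.
have := cardsD1 0 [set x | qform x == 0].
rewrite inE qform0 eqxx card_qform_eq0 qE add1n => /(congr1 predn) /= <-.
by move: a_ge p_gt0; move: (p ^ m.-1)%N => a; nia.
Qed.

(** As Q(g) = 0, a zero x of Q has Q(x + g) = B(x, g). So the zeros orthogonal to g are counted,
    without 0 and -g, which [quadric] excludes at x and at x + g. *)
Lemma diff_mult_quadric_in g : g \in quadric ->
  diff_mult quadric g = (p ^ m.-1 * p ^ m.-1 - p ^ m.-1 * (p - 1) - 2)%N.
Proof.
rewrite inE => /andP[nzg /eqP Qg]; rewrite diff_multE.
pose Z := [set x | qform x == 0]; pose N := [set x | polar x g != 0].
have ZN : (p * #|Z :&: N| = p ^ (2 * m) - p ^ (2 * m).-1)%N.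
  rewrite -(card_qform_polar nzg Qg); congr (p * _)%N.
  by apply: eq_card => x; rewrite !inE.
have sub : [set 0; - g] \subset Z :\: N.
  apply/subsetP => x; rewrite !inE negbK => /orP[] /eqP ->.
    by rewrite qform0 -[X in polar X _](mul0r g) polarZl ?mul0r ?eqxx // expr0n gtn_eqF.
  by rewrite qformN Qg -mulN1r polarZl ?polarxx ?Qg ?mulr0 ?eqxx // -signr_odd p_odd.
have -> : [set x | (x \in quadric) && (x + g \in quadric)]
    = (Z :\: N) :\: [set 0; - g].
  apply/setP => x; rewrite !inE negbK negb_or addr_eq0 qformD Qg addr0.
  by case: (qform x =P 0) => [->|_]; rewrite ?add0r !(andbT, andbF) //= -andbA.
rewrite cardsD (setIidPr sub) cards2; have := cardsID N Z; rewrite card_qform_eq0.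
rewrite eq_sym oppr_eq0 nzg /=; move: ZN; rewrite qqE qqE1 qE.
move: a_ge p_gt2; move: (p ^ m.-1)%N #|Z :&: N| #|Z :\: N| => a b c.
move=> le_pa lt_2p bE.
have -> : b = (a * a * (p - 1))%N by apply/eqP; rewrite -(eqn_pmul2l p_gt0) bE; nia.
by nia.
Qed.

Lemma diff_mult_quadric_notin g : g \notin quadric -> g != 0 ->
  diff_mult quadric g = (p ^ m.-1 * p ^ m.-1 - p ^ m.-1)%N.
Proof.
rewrite inE => /[swap] nzg; rewrite nzg /= => nzQ.
have := sum_diff_mult quadric.
(* The sum splits into the difference 0, taken k times, the k members of [quadric], each taken
   lambda times, and the remaining elements, which share the multiplicity of g. *)
rewrite (bigD1 0) //= diff_mult0 (bigID (mem quadric)) /=.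
have card_in : #|[pred i | (i != 0) && (i \in quadric)]| = #|quadric|.
  by apply: eq_card => x; rewrite !inE; case: (x == 0).
have card_out : #|[pred i | (i != 0) && (i \notin quadric)]|
    = (#|F| - #|[set x | qform x == 0%R]|)%N.
  rewrite -(cardsC [set x | qform x == 0]) addKn; apply: eq_card => x.
  by rewrite !inE; case: eqVneq => //= ->; rewrite qform0 eqxx.
rewrite (eq_bigr (fun=> p ^ m.-1 * p ^ m.-1 - p ^ m.-1 * (p - 1) - 2)%N); last first.
  by move=> x /andP[_ /diff_mult_quadric_in].
rewrite [X in (_ + (_ + X))%N](eq_bigr (fun=> diff_mult quadric g)); last first.
  move=> x; rewrite inE => /andP[-> /= nzx]; exact: diff_mult_const.
rewrite !sum_nat_const card_in card_out card_quadric card_qform_eq0 cardF qqE qE.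
exact: pds_mu_solve p_gt2 a_ge.
Qed.

Lemma quadricN : quadric = [set - s | s in quadric].
Proof.
have XN x : (- x \in quadric) = (x \in quadric) by rewrite !inE oppr_eq0 qformN.
apply/setP => x; apply/idP/imsetP => [Xx|[y Xy ->]]; last by rewrite XN.
by exists (- x); rewrite ?opprK ?XN.
Qed.

End Quadric.

(** * The union of cyclotomic classes as a quadric *)

Lemma bigcup_cyclotomic_class (p m : nat) (F : finFieldType) (alpha : {unit F}) :
    (1 < p)%N -> (1 < m)%N -> p \in [pchar F] -> #|F| = (p ^ (2 * m))%N ->
    generator [set: {unit F}] alpha ->
  let e := ((p ^ m - 1) %/ (p - 1))%N in
  \bigcup_(j in [set i : 'Z_e | Tr p m (val alpha ^+ (p ^ m + 1) ^+ i) == 0])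
    cyclotomic_class alpha e j = quadric F p m.
Proof.
move=> p_gt1 m_gt1 pcharFp cardF /eqP alphaE e.
have eE : (p ^ m - 1 = e * (p - 1))%N.
  by rewrite divnK // !subn1 predn_exp dvdn_mulr.
have e_gt1 : (1 < e)%N.
  have: (p ^ 2 <= p ^ m)%N by rewrite leq_exp2l.
  by rewrite -mulnn; move: eE; move: (p ^ m)%N => q; nia.
(* ['Z_e] has e elements only for e > 1, which comes from m > 1. *)
have ZeE : (Zp_trunc e).+2 = e by rewrite Zp_cast.
(* [w] is the norm of alpha^e. It lies in GF(p)^* because e (p - 1) (q + 1) = q^2 - 1, so Q vanishes
   on a whole class or nowhere on it. *)
pose w := val alpha ^+ e ^+ (p ^ m + 1).
have w1 : w ^+ (p - 1) = 1.
  rewrite /w -!exprM mulnCA -eE mulnC.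
  have -> : ((p ^ m - 1) * (p ^ m + 1) = #|F|.-1)%N.
    by rewrite cardF mul2n -addnn expnD; move: (p ^ m)%N => q; nia.
  by rewrite -card_finField_unit -FinRing.val_unitX expg_cardG ?inE.
have wp : w ^+ p = w.
  by rewrite -[X in _ ^+ X = _](prednK (ltnW p_gt1)) exprSr -subn1 w1 mul1r.
have nzw : w != 0 by rewrite !expf_neq0 // -unitfE (valP alpha).
have qformE (i n : nat) :
    qform p m (val (alpha ^+ (i + e * n))%g) = w ^+ n * qform p m (val alpha ^+ i).
  rewrite FinRing.val_unitX exprD exprM [_ * _ ^+ n]mulrC.
  have wnE : val alpha ^+ e ^+ n ^+ (p ^ m + 1) = w ^+ n by rewrite exprAC.
  by rewrite qform_mul wnE // exprAC wp.
apply/setP => x; apply/bigcupP/idP => [[j]|].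
  rewrite inE => Dj /imsetP[u /lcosetP[_ /cycleP[n ->] ->] ->].
  rewrite -expgM -expgD inE -unitfE (valP (alpha ^+ _)%g) qformE mulf_eq0.
  by rewrite /qform (exprAC (val alpha) j) Dj orbT.
rewrite inE => /andP[nzx Qx]; have ux : x \is a GRing.unit by rewrite unitfE.
have /cycleP[n xE] : FinRing.unit F ux \in <[alpha]>%g by rewrite -alphaE inE.
(* The class of alpha^n has index n modulo e. *)
have xE' : x = val (alpha ^+ (n %% e + e * (n %/ e)))%g.
  by rewrite addnC mulnC -divn_eq -xE.
have lt_ne : (n %% e < (Zp_trunc e).+2)%N by rewrite ZeE ltn_mod ltnW.
exists (Ordinal lt_ne); last first.
  apply/imsetP; exists (alpha ^+ n)%g; last by rewrite -xE.
  apply/lcosetP; exists ((alpha ^+ e) ^+ (n %/ e))%g; first exact: mem_cycle.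
  by rewrite -expgM -expgD addnC mulnC -divn_eq.
move: Qx; rewrite xE' qformE mulf_eq0 (negPf (expf_neq0 _ nzw)) /=.
by rewrite inE /qform exprAC.
Qed.

Theorem theorem3p4 (p m : nat) (hp : prime p) (p_odd : odd p) (hm : (1 < m)%N)
    (F : finFieldType) (hF : #|F| = (p ^ (2 * m))%N)
    (alpha : {unit F}) (halpha : generator [set: {unit F}] alpha) :
  let omega : F := val alpha ^+ (p ^ m + 1) in
  let e : nat := ((p ^ m - 1) %/ (p - 1))%N in
  let D : {set 'Z_e} := [set i : 'Z_e | Tr p m (omega ^+ (i : nat)) == 0] in
  let X : {set F} := \bigcup_(j in D) cyclotomic_class alpha e (j : nat) in
  regular_pds X
    (p ^ (2 * m))%N
    (p ^ (2 * m - 1) - p ^ (m - 1) * (p - 1) - 1)%N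
    (p ^ (2 * m - 2) - p ^ (m - 1) * (p - 1) - 2)%N
    (p ^ (2 * m - 2) - p ^ (m - 1))%N
  /\ X = [set x : F | (x != 0) && (Tr p m (x ^+ (p ^ m + 1)) == 0)].
Proof.
move=> omega e D X; have pcharFp := card_finPcharP hF hp.
have p_gt1 := prime_gt1 hp.
have XE : X = quadric F p m by apply: bigcup_cyclotomic_class.
split; last exact: XE.
have E2 : (p ^ (2 * m - 2) = p ^ m.-1 * p ^ m.-1)%N.
  by rewrite -expnD; congr (p ^ _)%N; lia.
have E1 : (p ^ (2 * m - 1) = p * p ^ m.-1 * p ^ m.-1)%N.
  by rewrite -mulnA -expnD -expnS; congr (p ^ _)%N; lia.
rewrite XE E1 E2 (subn1 m); split.
- split=> //.
  + rewrite card_quadric //; have: (0 < p ^ m.-1)%N by rewrite expn_gt0 ltnW.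
    case: (p ^ m.-1)%N => // b _; case: (p) p_gt1 => // s _; rewrite !subn1 /=.
    (* With p = s + 1 and a = b + 1, this writes p a^2 as k + 1 + a (p - 1), so that both truncated
       subtractions cancel. *)
    have -> : (s.+1 * b.+1 * b.+1 = ((s.+1 * b.+1 + 1) * b + 1) + b.+1 * s)%N.
      by ring.
    by rewrite addnK (addn1 (_ * b)%N).
  + by move=> g gX _; apply: diff_mult_quadric_in.
  + by move=> g; apply: diff_mult_quadric_notin.
- exact: quadricN.
by rewrite inE eqxx.
Qed.
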